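(* Let $\mathcal{S}=\langle\mathbf{Fm},\vdash\rangle$ be a finitary Hilbert-style logic over a language containing a binary connective $\longrightarrow$, such that modus ponens $\frac{\alpha,\ \alpha\longrightarrow\beta}{\beta}$ is one of its rules of inference, and such that the Deduction theorem holds in $\mathcal{S}$ (for all $\Sigma\cup\{\alpha,\beta\}\subseteq\mathit{Fm}$, $\Sigma\cup\{\alpha\}\vdash\beta$ implies $\Sigma\vdash\alpha\longrightarrow\beta$). Then the restricted rules companion of $\mathcal{S}$ coincides with the left variable inclusion companion of $\mathcal{S}$, i.e. $\vdash^{re}=\vdash^l$.
   Context: $\mathbf{Fm}$ is the formula algebra of a logical language (connectives of finite arity) over a countably infinite set $V$ of variables, universe $\mathit{Fm}$. A Hilbert-style logic is given by schematic (substitution-closed) sets of axioms $A$ and rules $R$ (written $\frac{\Gamma}{\alpha}$); $\Sigma\vdash\varphi$ iff there is a finite sequence ending in $\varphi$ each member of which is an axiom, a member of $\Sigma$, or obtained from earlier members by a rule. Finitary: whenever $\Sigma\vdash\varphi$ there is finite $\Sigma'\subseteq\Sigma$ with $\Sigma'\vdash\varphi$. $\mathrm{var}(\varphi)$ is the set of variables of $\varphi$, $\mathrm{var}(\Gamma)=\bigcup_{\gamma\in\Gamma}\mathrm{var}(\gamma)$. Left variable inclusion companion: $\Gamma\vdash^l\varphi$ iff there is $\Gamma'\subseteq\Gamma$ with $\mathrm{var}(\Gamma')\subseteq\mathrm{var}(\varphi)$ and $\Gamma'\vdash\varphi$. Restricted rules companion $\vdash^{re}$: the Hilbert-style consequence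 with the same axioms $A$ and rules $\{\frac{\Gamma}{\alpha}\in R\mid\mathrm{var}(\Gamma)\subseteq\mathrm{var}(\alpha)\}$. *)

(* Defs.v *)
From Stdlib Require List.
From mathcomp Require Import all_boot.
From mathcomp Require Import boolp classical_sets functions cardinality.

Set Implicit Arguments.
Unset Strict Implicit.
Unset Printing Implicit Defensive.

Local Open Scope classical_set_scope.

Record language := Language {
  connective : Type;
  arity : connective -> nat
}.

Section Syntax.
Variables (L : language) (V : Type).

Inductive fm : Type :=
| Var of V
| App (c : connective L) of ('I_(arity c) -> fm).

Fixpoint var (phi : fm) : set V :=
  match phi with
  | Var v => [set v]
  | App c args => \bigcup_i var (args i)
  end.

Definition vars (Gamma : set fm) : set V := \bigcup_(g in Gamma) var g.

(* The endomorphism of the formula algebra extending [sigma]. *)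
Fixpoint subst (sigma : V -> fm) (phi : fm) : fm :=
  match phi with
  | Var v => sigma v
  | App c args => App (fun i => subst sigma (args i))
  end.

(* Meant for [c] of arity 2, where it is the formula [c a b]; taking the
   arguments by their numerical index avoids a cast along [arity c = 2]. *)
Definition app2 (c : connective L) (a b : fm) : fm :=
  @App c (fun i => if i == 0 :> nat then a else b).

End Syntax.

Section Logic.
Variables (L : language) (V : Type).
Notation Fm := (fm L V).

Definition rule : Type := (set Fm * Fm)%type.

Definition consequence : Type := set Fm -> Fm -> Prop.

Definition axioms_schematic (A : set Fm) : Prop :=
  forall (sigma : V -> Fm) a, A a -> A (subst sigma a).

Definition rules_schematic (R : set rule) : Prop :=
  forall (sigma : V -> Fm) Gamma a,
    R (Gamma, a) -> R (subst sigma @` Gamma, subst sigma a).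

Definition derivation (A : set Fm) (R : set rule) (Sigma : set Fm)
    (s : seq Fm) : Prop :=
  forall s1 phi s2, s = s1 ++ phi :: s2 ->
    [\/ A phi,
        Sigma phi
      | exists2 Gamma, R (Gamma, phi) & forall g, Gamma g -> List.In g s1].

Definition hilbert (A : set Fm) (R : set rule) : consequence :=
  fun Sigma phi => exists s, derivation A R Sigma (rcons s phi).

Definition finitary (C : consequence) : Prop :=
  forall Sigma phi, C Sigma phi ->
    exists Sigma', [/\ finite_set Sigma', Sigma' `<=` Sigma & C Sigma' phi].

Definition modus_ponens_rule (imp : connective L) (R : set rule) : Prop :=
  forall a b, R ([set a; app2 imp a b], b).

Definition deduction_theorem (imp : connective L) (C : consequence) : Prop :=
  forall Sigma a b, C (Sigma `|` [set a]) b -> C Sigma (app2 imp a b).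

Definition left_companion (C : consequence) : consequence :=
  fun Gamma phi => exists Gamma',
    [/\ Gamma' `<=` Gamma, vars Gamma' `<=` var phi & C Gamma' phi].

Definition restricted_rules (R : set rule) : set rule :=
  [set r | R r /\ vars r.1 `<=` var r.2].

Definition restricted_companion (A : set Fm) (R : set rule) : consequence :=
  hilbert A (restricted_rules R).

End Logic.

(* Main.v *)
(** The inclusion of [restricted_companion] in [left_companion] is an induction
on derivations: a restricted rule only uses premises whose variables occur in
its conclusion, so the hypotheses with variables in [var phi] suffice for [phi].

Conversely, every theorem of the logic is a theorem of the restricted calculus.
If a theorem [a] follows from theorems by a rule [Gamma / a], replace every
variable outside [var a] by [a] itself: the instance obtained has conclusion [a]
and premises with variables in [var a], so it is a restricted rule; as [a] may
be closed, no variable of [a] could serve instead. For the induction to apply to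
the instantiated premises, it must cover all substitution instances at once.
A derivation of [phi] from [g1, ..., gn] with [var gi] included in [var phi]
then gives, by the deduction theorem, a restricted proof of
[g1 -> ... -> gn -> phi], and each modus ponens needed to detach the [gi] is
restricted because [phi] occurs in its conclusion. *)

From Stdlib Require List.
Require Import Defs.
From mathcomp Require Import all_boot.
From mathcomp Require Import boolp classical_sets functions cardinality.

Set Implicit Arguments.
Unset Strict Implicit.
Unset Printing Implicit Defensive.

Local Open Scope classical_set_scope.

Section Substitution.
Variables (L : language) (V : Type).
Implicit Types (sigma tau : V -> fm L V) (a b phi : fm L V).

Lemma subst_comp sigma tau phi :
  subst tau (subst sigma phi) = subst (fun v => subst tau (sigma v)) phi.
Proof. by elim: phi => //= c args IH; congr App; apply/funext. Qed.

Lemma subst_Var phi : subst (@Var L V) phi = phi.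
Proof. by elim: phi => //= c args IH; congr App; apply/funext. Qed.

Lemma subst_fixed sigma phi :
  (forall v, var phi v -> sigma v = Var L v) -> subst sigma phi = phi.
Proof.
elim: phi => [v|c args IH] /= fix_sigma; first exact: fix_sigma.
by congr App; apply/funext => i; apply: IH => v vi; apply: fix_sigma; exists i.
Qed.

Lemma var_subst sigma phi :
  var (subst sigma phi) `<=` \bigcup_(v in var phi) var (sigma v).
Proof.
elim: phi => [v|c args IH] /= w; first by exists v.
by case=> i _ /IH [v vi wv]; exists v => //; exists i.
Qed.

Lemma var_app2 (c : connective L) a b :
  var (app2 c a b) `<=` var a `|` var b.
Proof. by move=> v [i _] /=; case: ifP; [left | right]. Qed.

Lemma var_app2_r (c : connective L) a b :
  arity c = 2 -> var b `<=` var (app2 c a b).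
Proof.
(* The argument [b] sits at index 1, which exists because the arity is 2. *)
move=> c2 v bv; have lt1 : 1 < arity c by rewrite c2.
by exists (Ordinal lt1).
Qed.

End Substitution.

Section Hilbert.
Variables (L : language) (V : Type).
Implicit Types (A Sigma Gamma : set (fm L V)) (R : set (rule L V)).
Implicit Types (phi g : fm L V) (s l : seq (fm L V)).

Lemma derivation_nil A R Sigma : derivation A R Sigma [::].
Proof. by case. Qed.

Lemma derivation_rcons A R Sigma s phi :
  derivation A R Sigma (rcons s phi) <->
  derivation A R Sigma s /\
  [\/ A phi, Sigma phi
    | exists2 Gamma, R (Gamma, phi) & forall g, Gamma g -> List.In g s].
Proof.
split=> [ds|[ds dphi] s1 psi s2].
  split; last by apply: (ds s phi [::]); rewrite cats1.
  move=> s1 psi s2 es; apply: (ds s1 psi (rcons s2 phi)).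
  by rewrite es rcons_cat.
case/lastP: s2 => [|s2 chi]; first by rewrite cats1 => /rcons_inj [<- <-].
by rewrite -rcons_cons -rcons_cat => /rcons_inj [/ds].
Qed.

Lemma In_rcons g s phi : List.In g (rcons s phi) <-> List.In g s \/ g = phi.
Proof.
rewrite -cats1 List.in_app_iff /=.
by split=> -[]; [left | case=> // ->; right | left | move=> ->; right; left].
Qed.

Lemma derivation_cat A R Sigma s1 s2 :
  derivation A R Sigma s1 -> derivation A R Sigma s2 ->
  derivation A R Sigma (s1 ++ s2).
Proof.
move=> d1; elim/last_ind: s2 => [|s2 phi IH]; first by rewrite cats0.
move=> /derivation_rcons [d2 dphi]; rewrite -rcons_cat.
apply/derivation_rcons; split; first exact: IH.
case: dphi => [?|?|[Gamma RG inG]]; [exact: Or31 | exact: Or32 | apply: Or33].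
by exists Gamma => // g /inG ?; apply/List.in_app_iff; right.
Qed.

Lemma hilbert_axiom A R Sigma phi : A phi -> hilbert A R Sigma phi.
Proof.
move=> Aphi; exists [::]; apply/derivation_rcons.
by split; [exact: derivation_nil | exact: Or31].
Qed.

Lemma hilbert_hyp A R Sigma phi : Sigma phi -> hilbert A R Sigma phi.
Proof.
move=> Sphi; exists [::]; apply/derivation_rcons.
by split; [exact: derivation_nil | exact: Or32].
Qed.

(* A derivation is a finite sequence, so a rule is applicable only if its
   premises can be listed; [l] is such a list, possibly with extra members. *)
Lemma hilbert_rule A R Sigma l Gamma phi :
  R (Gamma, phi) -> (forall g, Gamma g -> List.In g l) ->
  (forall g, Gamma g -> hilbert A R Sigma g) -> hilbert A R Sigma phi.
Proof.
move=> RG Gl dG.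
(* Concatenate derivations of the members of [l] that lie in [Gamma]; the others may be underivable
   and are skipped. *)
suff [s ds sP] : exists2 s, derivation A R Sigma s &
    forall g, Gamma g -> List.In g l -> List.In g s.
  exists s; apply/derivation_rcons; split=> //.
  by apply: Or33; exists Gamma => // g Gg; apply: sP => //; apply: Gl.
elim: l {Gl} => [|a l [s ds sP]]; first by exists [::] => //; exact: derivation_nil.
have [Ga|nGa] := pselect (Gamma a); last first.
  by exists s => // g Gg [ag|]; [rewrite ag in nGa | exact: sP].
have [t dt] := dG a Ga; exists (s ++ rcons t a); first exact: derivation_cat.
move=> g Gg [<-|gl]; apply/List.in_app_iff.
  by right; apply/In_rcons; right.
by left; apply: sP.
Qed.

(** The rule case supplies a list covering the premises, so that [hilbert_rule] can reapply the
    rule, possibly in another calculus. *)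
Lemma hilbert_ind A R Sigma (P : fm L V -> Prop) :
  (forall phi, A phi -> P phi) -> (forall phi, Sigma phi -> P phi) ->
  (forall l Gamma phi, R (Gamma, phi) -> (forall g, Gamma g -> List.In g l) ->
    (forall g, Gamma g -> P g) -> P phi) ->
  forall phi, hilbert A R Sigma phi -> P phi.
Proof.
move=> PA PS PR phi [s ds].
suff: forall g, List.In g (rcons s phi) -> P g.
  by apply; apply/In_rcons; right.
elim/last_ind: (rcons s phi) ds => [//|t psi IH] /derivation_rcons [/IH Pt dpsi].
move=> g /In_rcons [/Pt //|->].
case: dpsi => [/PA //|/PS //|[Gamma RG Gt]].
by apply: (PR t Gamma) => // h /Gt /Pt.
Qed.

Lemma hilbert_trans A R Sigma Sigma' phi :
  (forall g, Sigma g -> hilbert A R Sigma' g) ->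
  hilbert A R Sigma phi -> hilbert A R Sigma' phi.
Proof.
move=> SS'; apply: hilbert_ind => // [psi|l Gamma psi RG Gl].
  exact: hilbert_axiom.
exact: hilbert_rule RG Gl.
Qed.

Lemma hilbert_sub A R Sigma Sigma' phi :
  Sigma `<=` Sigma' -> hilbert A R Sigma phi -> hilbert A R Sigma' phi.
Proof. by move=> SS'; apply: hilbert_trans => g /SS'; apply: hilbert_hyp. Qed.

End Hilbert.

Section Companions.
Variables (L : language) (V : Type) (A : set (fm L V)) (R : set (rule L V)).

Lemma restricted_companion_sub_left (Gamma : set (fm L V)) phi :
  restricted_companion A R Gamma phi -> left_companion (hilbert A R) Gamma phi.
Proof.
(* The largest admissible set of hypotheses; it depends on [phi] and so varies along the
   induction. *)
move=> dphi; exists (Gamma `&` [set g | var g `<=` var phi]).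
split=> [g []//|v [g [_ gphi] /gphi]//|].
elim/hilbert_ind: {phi} _ / dphi => [phi|phi Gphi|l Delta phi [RD vD] Dl IH].
- exact: hilbert_axiom.
- by apply: hilbert_hyp; split.
(* By the restriction on the rule, hypotheses admissible for a premise are admissible for the
   conclusion. *)
- apply: hilbert_rule RD Dl _ => g Dg; apply: hilbert_sub (IH g Dg).
  move=> h [Gh hg]; split=> // v /hg gv; apply: vD.
  by exists g.
Qed.

Lemma theorem_restricted_subst sigma phi :
  axioms_schematic A -> rules_schematic R ->
  hilbert A R set0 phi -> restricted_companion A R set0 (subst sigma phi).
Proof.
move=> schA schR dphi.
elim/hilbert_ind: {phi} _ / dphi sigma => [phi Aphi|//|l Gamma phi RG Gl IH] sigma.
  by apply: hilbert_axiom; apply: schA.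
set psi := subst sigma phi.
pose tau v := if `[< var psi v >] then Var L v else psi.
have tau_psi : subst tau psi = psi.
  by apply: subst_fixed => v /asboolP; rewrite /tau => ->.
have var_tau v : var (tau v) `<=` var psi.
  by rewrite /tau; case: asboolP => [psiv w /= ->|_ w].
(* Since [tau] fixes [psi], the instance of the rule under [rho] still concludes [psi]. Its premises
   are obtained from the induction hypothesis at [rho] instead of [sigma]. *)
pose rho v := subst tau (sigma v).
have rhoE g : subst rho g = subst tau (subst sigma g) by rewrite subst_comp.
apply: (@hilbert_rule _ _ _ _ _ (map (subst rho) l) (subst rho @` Gamma)).
- split; first by rewrite /= -tau_psi -rhoE; apply: schR.
  move=> v [_ [g Gg <-]]; rewrite rhoE => /(@var_subst _ _ tau) [w _].
  exact: var_tau.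
- by move=> _ [g /Gl gl <-]; apply: List.in_map.
- by move=> _ [g Gg <-]; apply: IH.
Qed.

Lemma theorem_restricted phi :
  axioms_schematic A -> rules_schematic R ->
  hilbert A R set0 phi -> restricted_companion A R set0 phi.
Proof.
move=> schA schR dphi; rewrite -[phi]subst_Var.
exact: theorem_restricted_subst.
Qed.

Lemma restricted_mp (imp : connective L) Sigma a b :
  modus_ponens_rule imp R -> var a `<=` var b ->
  restricted_companion A R Sigma a ->
  restricted_companion A R Sigma (app2 imp a b) ->
  restricted_companion A R Sigma b.
Proof.
move=> mp ab da dab.
apply: (@hilbert_rule _ _ _ _ _ [:: a; app2 imp a b] [set a; app2 imp a b]).
- split; first exact: mp.
  move=> v [g [->|->]]; first exact: ab.
  by move/(@var_app2 L V imp a b v) => [/ab|].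
- by move=> g [->|->]; [left | right; left].
- by move=> g [->|->].
Qed.

Lemma left_companion_sub_restricted (imp : connective L) Gamma phi :
  arity imp = 2 -> axioms_schematic A -> rules_schematic R ->
  finitary (hilbert A R) -> modus_ponens_rule imp R ->
  deduction_theorem imp (hilbert A R) ->
  left_companion (hilbert A R) Gamma phi -> restricted_companion A R Gamma phi.
Proof.
move=> imp2 schA schR fin mp ded [Delta [DG vD /fin [Sigma [finS SD dphi]]]].
suff: restricted_companion A R Sigma phi.
  by apply: hilbert_sub => g /SD /DG.
have {vD} vS : forall g, Sigma g -> var g `<=` var phi.
  by move=> g Sg v gv; apply: vD; exists g => //; apply: SD.
(* Listing a finite set calls for decidable equality on formulas, which [{classic _}] provides. *)
have [s SE] := (@finite_seqP {classic (fm L V)} Sigma).1 finS.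
rewrite {}SE in dphi vS *.
(* The goal [phi] must vary: discharging [a] turns it into [app2 imp a phi], whose variables include
   those of [phi], so the other hypotheses remain admissible. *)
elim: s phi dphi vS => [|a s IH] phi.
  rewrite set_nil => dphi _; exact: theorem_restricted.
have -> : [set` a :: s] = [set` s] `|` [set a].
  apply/seteqP; split=> g /=; rewrite inE.
    by case/predU1P; [right | left].
  by move=> sg; apply/predU1P; case: sg; [right | left].
move=> /ded dphi vs.
have phi_imp : var phi `<=` var (app2 imp a phi) by apply: var_app2_r.
apply: restricted_mp mp (vs a (or_intror erefl)) _ _.
  by apply: hilbert_hyp; right.
have {}IH := IH _ dphi (fun g sg => subset_trans (vs g (or_introl sg)) phi_imp).
exact: hilbert_sub (@subsetUl _ _ _) IH.
Qed.

End Companions.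

Theorem theorem4p3 (L : language) (V : Type) (V_countably_infinite : ([set: V] #= [set: nat])%card)
    (imp : connective L) (imp_binary : arity imp = 2)
    (A : set (fm L V)) (R : set (rule L V))
    (A_schematic : axioms_schematic A) (R_schematic : rules_schematic R)
    (S_finitary : finitary (hilbert A R))
    (R_mp : modus_ponens_rule imp R)
    (S_deduction : deduction_theorem imp (hilbert A R)) :
  restricted_companion A R = left_companion (hilbert A R).
Proof.
apply/funext => Gamma; apply/funext => phi; apply/propext; split.
  exact: restricted_companion_sub_left.
exact: left_companion_sub_restricted R_mp S_deduction.
Qed.
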